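(* Let $R$ be a commutative ring. Let $T$ be the set of Zariski-closed subsets of $\operatorname{Spec}(R)$, regarded as a complete idempotent semiring with (arbitrary) addition given by intersection, multiplication given by union, $0_T = \operatorname{Spec}(R)$ and $1_T = \emptyset$, and let $\tau : R \to T$ be the valuation $\tau(r) = \{P \in \operatorname{Spec}(R) : r \in P\}$. Then $\tau$ is the initial valuation among appropriately complete, multiplicatively idempotent positive valuations of $R$, that is: (1) for every $|R|$-complete idempotent semiring $\Gamma$ and every positive, multiplicatively idempotent valuation $\nu : R \to \Gamma$ there exists a unique semiring homomorphism $\varphi : T \to \Gamma$ preserving all sums of size at most $|R|$ such that $\nu = \varphi \circ \tau$; (2) if $R$ is Noetherian, then for every idempotent semiring $\Gamma$ and every positive, multiplicatively idempotent valuation $\nu : R \to \Gamma$ there exists a unique semiring homomorphism $\varphi : T \to \Gamma$ such that $\nu = \varphi \circ \tau$.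
   Context: Rings and semirings are unital. A semiring $(S,+,*,0,1)$ has commutative additive monoid $(S,+,0)$, multiplicative monoid $(S,*,1)$ (not necessarily commutative), multiplication distributing over addition on both sides, and $0$ annihilating. Semiring homomorphisms preserve $+,*,0,1$. A semiring is idempotent if $a+a=a$ for all $a$; it then carries the partial order $a\le b \iff a+b=a$ (so $a+b$ is the infimum of $a,b$, and $0$ is the greatest element). For a cardinal $\kappa$, an idempotent semiring $\Gamma$ is $\kappa$-complete if sums $\sum_{i\in I} b_i$ exist for all families with $|I|\le\kappa$, are the infima for $\le$, are compatible with partitions of the index set, extend the finite sums, and satisfy $a*\sum_i b_i=\sum_i a*b_i$ and $(\sum_i b_i)*a=\sum_i b_i*a$. It is complete if it is $\kappa$-complete for all $\kappa$. A valuation on a ring $R$ with values in an idempotent semiring $\Gamma$ is a map $\nu:R\to\Gamma$ with $\nu(0)=0$, $\nu(1)=1$, $\nu(-1)=1$, $\nu(ab)=\nu(a)\nu(b)$ and $\nu(a+b)\ge\nu(a)+\nu(b)$. It is positive if $\nu(r)\ge 1_\Gamma$ for all $r\in R$. A positive valuation $\nu:R\to\Gamma$ is multiplicatively idempotent if $\gamma*\gamma=\gamma$ for all $\gamma\in\Gamma$. *)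

(* Defs.v *)
From HB Require Import structures.
From mathcomp Require Import all_boot all_order all_algebra.
From mathcomp Require Import all_classical topology.

Set Implicit Arguments.
Unset Strict Implicit.
Unset Printing Implicit Defensive.

Import GRing.Theory.
Local Open Scope classical_set_scope.
Local Open Scope card_scope.
Local Open Scope ring_scope.

(* The Pz ("possibly zero") structures are used throughout: the trivial ring
   and the trivial semiring, in which 1 = 0, are allowed. *)

HB.mixin Record PzSemiRing_isIdempotent S of GRing.PzSemiRing S := {
  addrr_idem : forall a : S, a + a = a
}.

#[short(type="idemSemiRingType")]
HB.structure Definition IdemSemiRing :=
  {S of PzSemiRing_isIdempotent S & GRing.PzSemiRing S}.

(* a + b is the infimum of a and b, and 0 is the greatest element. *)
Definition idem_le (S : idemSemiRingType) (a b : S) : Prop := a + b = a.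

(* The cardinal kappa is represented by a type K of that cardinality. The
   operation [csum] is total for convenience, but it is only specified for
   families with at most kappa members. A partition of I is given as the family
   of fibres of a map p : I -> J (so that empty parts are allowed). *)
HB.mixin Record IdemSemiRing_isCardComplete (K : Type) S of IdemSemiRing S := {
  csum : forall I : Type, (I -> S) -> S;
  csum_le : forall (I : Type) (b : I -> S), [set: I] #<= [set: K] ->
    forall i, idem_le (csum I b) (b i);
  csum_glb : forall (I : Type) (b : I -> S), [set: I] #<= [set: K] ->
    forall c, (forall i, idem_le c (b i)) -> idem_le c (csum I b);
  csum_partition : forall (I J : Type) (p : I -> J) (b : I -> S),
    [set: I] #<= [set: K] -> [set: J] #<= [set: K] ->
    csum I b = csum J (fun j => csum {i : I | p i = j} (fun i => b (sval i)));
  csum_fin : forall (I : finType) (b : I -> S), [set: I] #<= [set: K] ->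
    csum I b = \sum_(i : I) b i;
  csum_mulr : forall (I : Type) (b : I -> S) (a : S), [set: I] #<= [set: K] ->
    a * csum I b = csum I (fun i => a * b i);
  csum_mull : forall (I : Type) (b : I -> S) (a : S), [set: I] #<= [set: K] ->
    csum I b * a = csum I (fun i => b i * a)
}.

#[short(type="cardCompleteType")]
HB.structure Definition CardComplete (K : Type) :=
  {S of IdemSemiRing_isCardComplete K S & IdemSemiRing S}.

Arguments csum K {s I} b.

Definition preserves_csum (K : Type) (S T : cardCompleteType K) (f : S -> T) :
    Prop :=
  forall (I : Type) (b : I -> S), [set: I] #<= [set: K] ->
    f (csum K b) = csum K (fun i => f (b i)).

Arguments preserves_csum K {S T} f.

Record valuation (R : pzRingType) (G : idemSemiRingType) := Valuation {
  val_fun :> R -> G;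
  val_0 : val_fun 0 = 0;
  val_1 : val_fun 1 = 1;
  val_N1 : val_fun (- 1) = 1;
  val_M : forall a b, val_fun (a * b) = val_fun a * val_fun b;
  val_D : forall a b, idem_le (val_fun a + val_fun b) (val_fun (a + b))
}.

Definition positive_valuation (R : pzRingType) (G : idemSemiRingType)
    (nu : valuation R G) : Prop :=
  forall r, idem_le 1 (nu r).

(* The condition bears on all of G, not only on the image of nu. *)
Definition mul_idempotent (R : pzRingType) (G : idemSemiRingType)
    (nu : valuation R G) : Prop :=
  forall g : G, g * g = g.

(* MathComp's [idealr_closed] and [prime_idealr_closed] require a nontrivial
   ring, and the former requires ideals to be proper. *)
Definition ideal (R : comPzRingType) (I : set R) : Prop :=
  [/\ I 0, forall a b, I a -> I b -> I (a + b) & forall a b, I b -> I (a * b)].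

Definition prime_ideal (R : comPzRingType) (P : set R) : Prop :=
  [/\ ideal P, ~ P 1 & forall a b, P (a * b) -> P a \/ P b].

Definition noetherian (R : comPzRingType) : Prop :=
  forall I : set R, ideal I ->
    exists2 E : set R, finite_set E & I = smallest (@ideal R) E.

Record spec (R : comPzRingType) := Spec {
  spec_set :> set R;
  spec_prime : prime_ideal spec_set
}.

HB.instance Definition _ (R : comPzRingType) := gen_eqMixin (spec R).
HB.instance Definition _ (R : comPzRingType) := gen_choiceMixin (spec R).

Definition zero_locus (R : comPzRingType) (E : set R) : set (spec R) :=
  [set P | E `<=` spec_set P].

Definition zariski_open (R : comPzRingType) (U : set (spec R)) : Prop :=
  exists E : set R, ~` U = zero_locus E.

Section ZariskiTopology.
Variable R : comPzRingType.

Lemma zariski_openT : zariski_open [set: spec R].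
Proof.
exists setT; rewrite setCT; apply/seteqP; split=> // P /(_ 1 I).
by case: (spec_prime P).
Qed.

Lemma zariski_openI : setI_closed (@zariski_open R).
Proof.
move=> U V [E UE] [F VF].
exists [set r | exists2 a, E a & exists2 b, F b & r = a * b].
rewrite setCI UE VF; apply/seteqP; split=> P.
  have [[_ _ PM] _ _] := spec_prime P.
  case=> PE _ [a Ea [b Fb ->]]; last exact/PM/PE.
  by rewrite mulrC; apply/PM/PE.
move=> PEF; apply: contrapT => /not_orP[/existsNP[a /not_implyP[Ea Pa]]].
move=> /existsNP[b /not_implyP[Fb Pb]].
have [_ _ Pprime] := spec_prime P.
by case: (Pprime a b) => //; apply: PEF; exists a => //; exists b.
Qed.

Lemma zariski_open_bigU (I : Type) (f : I -> set (spec R)) :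
  (forall i, zariski_open (f i)) -> zariski_open (\bigcup_i f i).
Proof.
move=> /choice[E fE]; exists (\bigcup_i E i); rewrite setC_bigcup.
apply/seteqP; split=> P.
  by move=> Pf r [i _ Er]; have := Pf i Logic.I; rewrite fE; apply.
by move=> PE i _; rewrite fE => r Er; apply: PE; exists i.
Qed.

HB.instance Definition _ := isOpenTopological.Build (spec R)
  zariski_openT zariski_openI zariski_open_bigU.

Lemma zariski_closedP (C : set (spec R)) :
  closed C <-> exists E : set R, C = zero_locus E.
Proof. by rewrite -openC; split=> -[E] /=; exists E; rewrite ?setCK // -[C]setCK. Qed.

End ZariskiTopology.

Record zclosed (R : comPzRingType) := ZClosed {
  zclosed_set :> set (spec R);
  zclosed_closed : closed zclosed_set
}.

Arguments ZClosed {R zclosed_set} zclosed_closed.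
Arguments zclosed_closed {R} z.

HB.instance Definition _ (R : comPzRingType) := gen_eqMixin (zclosed R).
HB.instance Definition _ (R : comPzRingType) := gen_choiceMixin (zclosed R).

Section ZariskiSemiring.
Variable R : comPzRingType.
Implicit Types A B C : zclosed R.

Lemma zclosed_inj A B : zclosed_set A = zclosed_set B -> A = B.
Proof.
case: A B => [A cA] [B cB] /= AB; case: B / AB cB => cB.
by congr ZClosed; exact: Prop_irrelevance.
Qed.

Definition zclosed0 : zclosed R := ZClosed (@closedT (spec R)).
Definition zclosed1 : zclosed R := ZClosed (@closed0 (spec R)).
Definition zclosed_add A B : zclosed R :=
  ZClosed (closedI (zclosed_closed A) (zclosed_closed B)).
Definition zclosed_mul A B : zclosed R :=
  ZClosed (closedU (zclosed_closed A) (zclosed_closed B)).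

Lemma zclosed_addA : associative zclosed_add.
Proof. by move=> A B C; apply: zclosed_inj; exact: setIA. Qed.
Lemma zclosed_addC : commutative zclosed_add.
Proof. by move=> A B; apply: zclosed_inj; exact: setIC. Qed.
Lemma zclosed_add0 : left_id zclosed0 zclosed_add.
Proof. by move=> A; apply: zclosed_inj; exact: setTI. Qed.
Lemma zclosed_mulA : associative zclosed_mul.
Proof. by move=> A B C; apply: zclosed_inj; exact: setUA. Qed.
Lemma zclosed_mul1l : left_id zclosed1 zclosed_mul.
Proof. by move=> A; apply: zclosed_inj; exact: set0U. Qed.
Lemma zclosed_mul1r : right_id zclosed1 zclosed_mul.
Proof. by move=> A; apply: zclosed_inj; exact: setU0. Qed.
Lemma zclosed_mulDl : left_distributive zclosed_mul zclosed_add.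
Proof. by move=> A B C; apply: zclosed_inj; exact: setUIl. Qed.
Lemma zclosed_mulDr : right_distributive zclosed_mul zclosed_add.
Proof. by move=> A B C; apply: zclosed_inj; exact: setUIr. Qed.
Lemma zclosed_mul0l : left_zero zclosed0 zclosed_mul.
Proof. by move=> A; apply: zclosed_inj; exact: setTU. Qed.
Lemma zclosed_mul0r : right_zero zclosed0 zclosed_mul.
Proof. by move=> A; apply: zclosed_inj; exact: setUT. Qed.

HB.instance Definition _ := GRing.isPzSemiRing.Build (zclosed R)
  zclosed_addA zclosed_addC zclosed_add0 zclosed_mulA zclosed_mul1l
  zclosed_mul1r zclosed_mulDl zclosed_mulDr zclosed_mul0l zclosed_mul0r.

Lemma zclosed_addrr A : A + A = A.
Proof. by apply: zclosed_inj; exact: setIid. Qed.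

HB.instance Definition _ :=
  PzSemiRing_isIdempotent.Build (zclosed R) zclosed_addrr.

Lemma zclosed_leE A B : idem_le A B <-> zclosed_set A `<=` zclosed_set B.
Proof.
split=> [AB|AB]; last by apply: zclosed_inj; exact/setIidPl.
by apply/setIidPl; exact: (congr1 (@zclosed_set R) AB).
Qed.

Definition zclosed_csum (I : Type) (b : I -> zclosed R) : zclosed R :=
  @ZClosed R (\bigcap_i zclosed_set (b i))
    (closed_bigI (fun i _ => zclosed_closed (b i))).

Section Complete.
Variable K : Type.

Lemma zclosed_csum_le (I : Type) (b : I -> zclosed R) :
  [set: I] #<= [set: K] -> forall i, idem_le (zclosed_csum b) (b i).
Proof. by move=> _ i; apply/zclosed_leE => P; apply. Qed.

Lemma zclosed_csum_glb (I : Type) (b : I -> zclosed R) :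
  [set: I] #<= [set: K] ->
  forall C, (forall i, idem_le C (b i)) -> idem_le C (zclosed_csum b).
Proof.
move=> _ C Cb; apply/zclosed_leE => P CP i _.
by have /zclosed_leE := Cb i; apply.
Qed.

Lemma zclosed_csum_partition (I J : Type) (p : I -> J) (b : I -> zclosed R) :
  [set: I] #<= [set: K] -> [set: J] #<= [set: K] ->
  zclosed_csum b =
    zclosed_csum (fun j => zclosed_csum (fun i : {i | p i = j} => b (sval i))).
Proof.
move=> _ _; apply: zclosed_inj; apply/seteqP; split=> P /= bP.
  by move=> j _ i _; exact: bP.
by move=> i _; exact: (bP (p i) Logic.I (exist _ i erefl)).
Qed.

Lemma zclosed_csum_fin (I : finType) (b : I -> zclosed R) :
  [set: I] #<= [set: K] -> zclosed_csum b = \sum_(i : I) b i.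
Proof.
move=> _; apply: zclosed_inj.
have -> : zclosed_set (\sum_i b i) =
    \big[setI/setT]_(i <- index_enum I) zclosed_set (b i).
  by apply: (big_morph (@zclosed_set R)).
rewrite -bigcap_seq; apply/seteqP; split=> P bP i _; first exact: bP.
by apply: bP => /=; rewrite mem_index_enum.
Qed.

Lemma zclosed_csum_mulr (I : Type) (b : I -> zclosed R) A :
  [set: I] #<= [set: K] ->
  A * zclosed_csum b = zclosed_csum (fun i => A * b i).
Proof.
move=> _; apply: zclosed_inj; apply/seteqP; split=> P /=.
  by case=> [AP|bP] i _; [left|right; exact: bP].
move=> AbP; have [AP|nAP] := pselect (zclosed_set A P); first by left.
by right=> i _; have [] := AbP i Logic.I.
Qed.

Lemma zclosed_csum_mull (I : Type) (b : I -> zclosed R) A :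
  [set: I] #<= [set: K] ->
  zclosed_csum b * A = zclosed_csum (fun i => b i * A).
Proof.
move=> _; apply: zclosed_inj; apply/seteqP; split=> P /=.
  by case=> [bP|AP] i _; [left; exact: bP|right].
move=> AbP; have [AP|nAP] := pselect (zclosed_set A P); first by right.
by left=> i _; have [] := AbP i Logic.I.
Qed.

HB.instance Definition _ := IdemSemiRing_isCardComplete.Build K (zclosed R)
  zclosed_csum_le zclosed_csum_glb zclosed_csum_partition zclosed_csum_fin
  zclosed_csum_mulr zclosed_csum_mull.

End Complete.

Lemma tau_closed (r : R) : closed [set P : spec R | spec_set P r].
Proof.
apply/zariski_closedP; exists [set r]; apply/seteqP; split=> P /=.
  by move=> Pr _ ->.
exact.
Qed.

Definition tau_fun (r : R) : zclosed R := ZClosed (@tau_closed r).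

Lemma tau_0 : tau_fun 0 = 0.
Proof.
apply: zclosed_inj; apply/seteqP; split=> // P _ /=.
by have [[]] := spec_prime P.
Qed.

Lemma tau_1 : tau_fun 1 = 1.
Proof.
by apply: zclosed_inj; apply/seteqP; split=> // P /=; have [] := spec_prime P.
Qed.

Lemma tau_N1 : tau_fun (- 1) = 1.
Proof.
apply: zclosed_inj; apply/seteqP; split=> // P /= PN1.
have [[_ _ PM] P1 _] := spec_prime P.
by apply: P1; rewrite -[1]mulr1 -mulrNN; exact: PM.
Qed.

Lemma tau_M (a b : R) : tau_fun (a * b) = tau_fun a * tau_fun b.
Proof.
apply: zclosed_inj; apply/seteqP; split=> P /=.
  by have [_ _] := spec_prime P; apply.
have [[_ _ PM] _ _] := spec_prime P.
by case=> ?; [rewrite mulrC|]; exact: PM.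
Qed.

Lemma tau_D (a b : R) : idem_le (tau_fun a + tau_fun b) (tau_fun (a + b)).
Proof.
apply/zclosed_leE => P [/= Pa Pb].
by have [[_ PD _] _ _] := spec_prime P; exact: PD.
Qed.

Definition tau : valuation R (zclosed R) :=
  Valuation tau_0 tau_1 tau_N1 tau_M tau_D.

Lemma tau_positive : positive_valuation tau.
Proof. by move=> r; apply/zclosed_leE. Qed.

Lemma tau_mul_idempotent : mul_idempotent tau.
Proof. by move=> A; apply: zclosed_inj; exact: setUid. Qed.

End ZariskiSemiring.

(* Main.v *)
Require Import Defs.
From HB Require Import structures.
From mathcomp Require Import all_boot all_order all_algebra.
From mathcomp Require Import all_classical topology.

(** For any [c] in [G], the elements [r] with [c <= nu r] form a radical ideal
    of [R]. Hence, by the Nullstellensatz, if [c <= nu e] for all [e] in [E] and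
    [V(E)] is contained in [V(r)], then [c <= nu r]. So the infimum [phi Z] of
    the [nu r], where [r] vanishes on [Z], turns intersections of closed sets
    into infima; it is available in [G] as a sum of at most [|R|] terms, or, when [R] is
    Noetherian, as a finite sum over generators of the vanishing ideal of [Z].
    The same sums express [Z] through the [tau r], which gives uniqueness. *)

Set Implicit Arguments.
Unset Strict Implicit.
Unset Printing Implicit Defensive.

Import GRing.Theory.
Local Open Scope classical_set_scope.
Local Open Scope card_scope.
Local Open Scope ring_scope.

(** * Prime ideals avoiding the powers of an element *)

Section PrimeAvoidance.
Variable R : comPzRingType.
Implicit Types (r a b : R) (J M : set R).

Lemma ideal_adjoin M a : ideal M ->
  ideal [set m + x * a | m in M & x in [set: R]].
Proof.
move=> [M0 MD MM]; split.
- by exists 0 => //; exists 0 => //; rewrite mul0r addr0.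
- move=> _ _ [m Mm [x _ <-]] [n Mn [y _ <-]].
  by exists (m + n); [exact: MD|exists (x + y); rewrite // mulrDl addrACA].
- move=> b _ [m Mm [x _ <-]].
  by exists (b * m); [exact: MM|exists (b * x); rewrite // mulrDr mulrA].
Qed.

(** If [a] and [b] lie outside [M], maximality puts powers of [r] in [M + Ra] and in [M + Rb]. Their
    product is a power of [r] in [M + Rab], which is [M] once [a * b] is in [M]. *)
Lemma maximal_avoiding_prime r M : ideal M -> (forall n, ~ M (r ^+ n)) ->
  (forall J, M `<=` J -> ideal J -> (forall n, ~ J (r ^+ n)) -> J `<=` M) ->
  prime_ideal M.
Proof.
move=> iM Mr Mmax; have [M0 MD MM] := iM; split=> //; first exact: (Mr 0%N).
have pow a : ~ M a -> exists m x n, M m /\ r ^+ n = m + x * a.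
  move=> Ma; apply: contrapT => nex; apply: Ma.
  apply: (Mmax _ _ (ideal_adjoin a iM)).
  - by move=> m Mm; exists m => //; exists 0 => //; rewrite mul0r addr0.
  - by move=> n [m Mm [x _ E]]; apply: nex; exists m, x, n.
  - by exists 0 => //; exists 1 => //; rewrite mul1r add0r.
move=> a b Mab; apply: contrapT => /not_orP[/pow[m [x [n [Mm En]]]]].
move=> /pow[m' [y [n' [Mm' En']]]]; apply: (Mr (n + n')%N).
rewrite exprD En En' mulrDr [_ * (y * b)]mulrDl addrA mulrACA.
apply: (MD); last exact: MM.
by apply: (MD); [|rewrite mulrC]; exact: MM.
Qed.

Lemma exists_prime_avoiding r J : ideal J -> (forall n, ~ J (r ^+ n)) ->
  exists2 P : spec R, J `<=` spec_set P & ~ spec_set P r.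
Proof.
move=> [J0 JD JM] Jr.
(* The union with [J] makes the empty chain harmless. *)
pose avoids A := ideal (J `|` A) /\ forall n, ~ (J `|` A) (r ^+ n).
have [F Favoids Ftot|M [[iM Mr] Mmax]] := @Zorn_bigcup R avoids.
  split=> [|n [|[A FA An]]]; [|exact: Jr|]; last first.
    by have [_ /(_ n)] := Favoids _ FA; apply; right.
  have chain A x : F A -> (J `|` A) x -> (J `|` \bigcup_(X in F) X) x.
    by move=> FA [Jx|Ax]; [left|right; exists A].
  split; first by left.
  - move=> a b [Ja|[A FA Aa]] [Jb|[B FB Bb]].
    + by left; exact: JD.
    + have [[_ BD _] _] := Favoids _ FB.
      by apply: (chain B) => //; apply: BD; [left|right].
    + have [[_ AD _] _] := Favoids _ FA.
      by apply: (chain A) => //; apply: AD; [right|left].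
    + have [AB|BA] := Ftot _ _ FA FB.
        have [[_ BD _] _] := Favoids _ FB.
        by apply: (chain B) => //; apply: BD; right => //; exact: AB.
      have [[_ AD _] _] := Favoids _ FA.
      by apply: (chain A) => //; apply: AD; right => //; exact: BA.
  - move=> a b [Jb|[A FA Ab]]; first by left; exact: JM.
    have [[_ _ AM] _] := Favoids _ FA.
    by apply: (chain A) => //; apply: AM; right.
have pM : prime_ideal (J `|` M).
  (* Zorn's maximality ranges over sets whose union with [J] is an avoiding ideal; an avoiding ideal
     [N] containing [J] is one of them, its union with [J] being [N] itself. *)
  apply: (@maximal_avoiding_prime r) => // N sN iN Nr; apply: contrapT => nNM.
  have JN : J `|` N = N.
    by apply/setUidPr => x Jx; apply: sN; left.
  apply: (Mmax N); last by rewrite /avoids JN.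
  split; first by move=> x Mx; apply: sN; right.
  by move=> NM; apply: nNM => x /NM; right.
exists (Spec pM) => [x Jx|/=]; first by left.
exact: (Mr 1%N).
Qed.

End PrimeAvoidance.

(** * The order of an idempotent semiring *)

Section IdempotentOrder.
Variable S : idemSemiRingType.
Implicit Types a b c d : S.

Lemma idem_le_refl a : idem_le a a.
Proof. exact: addrr_idem. Qed.

Lemma idem_le_anti a b : idem_le a b -> idem_le b a -> a = b.
Proof. by rewrite /idem_le => ab ba; rewrite -ab addrC. Qed.

Lemma idem_le_trans b a c : idem_le a b -> idem_le b c -> idem_le a c.
Proof. by rewrite /idem_le => ab bc; rewrite -ab -addrA bc. Qed.

Lemma idem_le_add c a b : idem_le c a -> idem_le c b -> idem_le c (a + b).
Proof. by rewrite /idem_le => ca cb; rewrite addrA ca. Qed.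

Lemma idem_add_lel a b : idem_le (a + b) a.
Proof. by rewrite /idem_le addrAC addrr_idem. Qed.

Lemma idem_add_ler a b : idem_le (a + b) b.
Proof. by rewrite addrC; exact: idem_add_lel. Qed.

Lemma idem_le_mul a b c d :
  idem_le a b -> idem_le c d -> idem_le (a * c) (b * d).
Proof.
move=> ab cd; apply: (@idem_le_trans (b * c)).
  by rewrite /idem_le -mulrDl ab.
by rewrite /idem_le -mulrDr cd.
Qed.

Lemma idem_sum_le (I : eqType) (s : seq I) (f : I -> S) i :
  i \in s -> idem_le (\sum_(j <- s) f j) (f i).
Proof.
move=> /(big_rem i) ->; exact: idem_add_lel.
Qed.

Lemma idem_le_sum (I : eqType) (s : seq I) (f : I -> S) c :
  (forall i, i \in s -> idem_le c (f i)) -> idem_le c (\sum_(j <- s) f j).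
Proof.
move=> cf; rewrite big_seq; elim/big_ind: _ => //; first exact: addr0.
exact: idem_le_add.
Qed.

End IdempotentOrder.

(** Uniqueness in [exists!] is equality of bundled morphisms; proof irrelevance reduces it to
    equality of the underlying functions. *)
Lemma rmorphism_eq (A B : pzSemiRingType) (f g : {rmorphism A -> B}) :
  f =1 g -> f = g.
Proof.
case: f g => [f [[fD] [fM]]] [g [[gD] [gM]]] /funext /= fg.
case: g / fg gD gM => gD gM.
by rewrite (Prop_irrelevance fD gD) (Prop_irrelevance fM gM).
Qed.

(** * Vanishing ideals of closed sets *)

Section Vanishing.
Variable R : comPzRingType.
Implicit Types (Z W : zclosed R) (r : R).

Definition vanishing Z : set R := [set r | idem_le Z (tau R r)].

Lemma vanishing_tau r : vanishing (tau R r) r.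
Proof. exact: idem_le_refl. Qed.

(** A closed [Z] is some [V(E)], and every element of [E] vanishes on [Z]; so [Z] is the infimum of
    the [tau R r] above it. *)
Lemma vanishing_glb C Z :
  (forall r, vanishing Z r -> idem_le C (tau R r)) -> idem_le C Z.
Proof.
move=> CZ; apply/zclosed_leE => P CP.
have /zariski_closedP[E ZE] := zclosed_closed Z.
rewrite ZE => r Er; have /CZ/zclosed_leE/(_ _ CP)// : vanishing Z r.
by apply/zclosed_leE => Q; rewrite ZE; apply.
Qed.

End Vanishing.

(** * Nullstellensatz for valuations, and morphisms given by infima *)

Section Valuation.
Variables (R : comPzRingType) (G : idemSemiRingType) (nu : valuation R G).
Hypotheses (nu_pos : positive_valuation nu) (nu_idem : mul_idempotent nu).
Implicit Types (Z W : zclosed R) (c : G).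

Definition above c : set R := [set r | idem_le c (nu r)].

(** Positivity yields absorption: [c = 1 * c <= nu a * nu b]. *)
Lemma above_ideal c : ideal (above c).
Proof.
split=> [|a b ca cb|a b cb]; rewrite /above /=.
- by rewrite val_0 /idem_le addr0.
- by apply: idem_le_trans (val_D nu a b); exact: idem_le_add.
- by rewrite val_M -[c]mul1r; apply: idem_le_mul; first exact: nu_pos.
Qed.

(** Multiplicative idempotence gives all positive powers of [r] the same value; for [n = 0],
    positivity gives [c <= 1 <= nu r]. *)
Lemma above_radical c r n : above c (r ^+ n) -> above c r.
Proof.
case: n => [|n]; rewrite /above /=.
  by rewrite val_1 => c1; exact: idem_le_trans (nu_pos r).
suff -> : nu (r ^+ n.+1) = nu r by [].
elim: n => [|n IH]; first by rewrite expr1.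
by rewrite exprS val_M IH nu_idem.
Qed.

(** Otherwise the radical ideal [above c] lies in a prime that misses [r]; this prime is a point of
    [V(E)] outside [V(r)]. *)
Lemma above_nullstellensatz c (E : set R) r :
  E `<=` above c -> zero_locus E `<=` [set P | spec_set P r] -> above c r.
Proof.
move=> Ec Er; apply: contrapT => cr.
have [|P cP] := exists_prime_avoiding (above_ideal c) (r := r).
  by move=> n /above_radical.
by apply; apply: Er => e /Ec /cP.
Qed.

Section Infimum.
Variable phi : zclosed R -> G.
Hypothesis phi_le : forall Z r, vanishing Z r -> idem_le (phi Z) (nu r).
Hypothesis phi_glb : forall Z c,
  (forall r, vanishing Z r -> idem_le c (nu r)) -> idem_le c (phi Z).
(** Products need not distribute over infima in an arbitrary [G], so this is asked separately; it
    will come from distributivity over the sums that realise [phi]. *)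
Hypothesis phi_glbM : forall Z W c,
  (forall r s, vanishing Z r -> vanishing W s -> idem_le c (nu r * nu s)) ->
  idem_le c (phi Z * phi W).

Lemma infimum_tau r : nu r = phi (tau R r).
Proof.
apply: idem_le_anti; last exact/phi_le/vanishing_tau.
apply: phi_glb => s /zclosed_leE rs.
apply: (@above_nullstellensatz _ [set r]) => [_ ->|P Pr].
  exact: idem_le_refl.
by apply: rs; exact: Pr.
Qed.

(** The vanishing ideals of the [b i] together cut out [Z], so the Nullstellensatz applies to their
    union. *)
Lemma infimum_bigcap (I : Type) (b : I -> zclosed R) Z c :
  zclosed_set Z = \bigcap_i zclosed_set (b i) ->
  (forall i, idem_le c (phi (b i))) -> idem_le c (phi Z).
Proof.
move=> Zb cb; apply: phi_glb => r /zclosed_leE Zr.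
apply: (@above_nullstellensatz _ (\bigcup_i vanishing (b i))).
  by move=> s [i _ bs]; apply: idem_le_trans (cb i) _; exact: phi_le.
move=> P bP; apply: Zr; rewrite Zb => i _.
have /zariski_closedP[E bE] := zclosed_closed (b i).
rewrite bE => e Ee; apply: bP; exists i => //.
by apply/zclosed_leE => Q; rewrite bE; apply.
Qed.

Lemma infimum_mono Z W : idem_le Z W -> idem_le (phi Z) (phi W).
Proof.
by move=> ZW; apply: phi_glb => r Wr; apply: phi_le; exact: idem_le_trans Wr.
Qed.

Lemma infimum_nmod_morphism : nmod_morphism phi.
Proof.
split; first by rewrite -(tau_0 R) -[tau_fun _]/(tau R 0) -infimum_tau val_0.
move=> Z W; apply: idem_le_anti.
  by apply: idem_le_add; apply: infimum_mono;
    [exact: idem_add_lel|exact: idem_add_ler].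
apply: (@infimum_bigcap bool (fun i => if i then Z else W)).
  apply/seteqP; split=> P; first by case=> ZP WP [].
  by move=> ZW; split; [exact: (ZW true)|exact: (ZW false)].
by case; [exact: idem_add_lel|exact: idem_add_ler].
Qed.

Lemma infimum_monoid_morphism : monoid_morphism phi.
Proof.
split; first by rewrite -(tau_1 R) -[tau_fun _]/(tau R 1) -infimum_tau val_1.
move=> Z W; apply: idem_le_anti.
  (* If [r] vanishes on [Z] and [s] on [W], then [r * s] vanishes on their union. *)
  apply: phi_glbM => r s Zr Ws; rewrite -val_M; apply: phi_le.
  by rewrite /vanishing /= tau_M; exact: idem_le_mul.
(* Writing [nu r] as [nu r * nu r] leaves one factor for [Z] and one for [W], as [r] vanishes on
   both. *)
apply: phi_glb => r /zclosed_leE ZWr; rewrite -[nu r]nu_idem.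
by apply: idem_le_mul; apply: phi_le; apply/zclosed_leE => P ?;
  apply: ZWr; [left|right].
Qed.

HB.instance Definition _ :=
  GRing.isNmodMorphism.Build _ _ phi infimum_nmod_morphism.
HB.instance Definition _ :=
  GRing.isMonoidMorphism.Build _ _ phi infimum_monoid_morphism.

Lemma infimum_rmorphism : exists f : {rmorphism zclosed R -> G}, f =1 phi.
Proof. by exists phi. Qed.

End Infimum.

End Valuation.

(** * The complete case *)

Section Complete.
Variables (R : comPzRingType) (G : cardCompleteType R) (nu : valuation R G).
Hypotheses (nu_pos : positive_valuation nu) (nu_idem : mul_idempotent nu).

Lemma card_sig_le (A : set R) : [set: {r | A r}] #<= [set: R].
Proof.
by rewrite -(preimage_setT (@sval _ A)); apply: card_ge_preimage => r s _ _;
  exact: eq_sig_hprop (fun _ => @Prop_irrelevance _) _ _.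
Qed.

Definition inf_csum (Z : zclosed R) : G :=
  csum R (fun r : {r | vanishing Z r} => nu (sval r)).

Lemma inf_csum_le Z r : vanishing Z r -> idem_le (inf_csum Z) (nu r).
Proof.
move=> Zr; exact: (@csum_le _ _ _ (fun r => nu (sval r)) (card_sig_le _) (exist _ r Zr)).
Qed.

Lemma inf_csum_glb Z c :
  (forall r, vanishing Z r -> idem_le c (nu r)) -> idem_le c (inf_csum Z).
Proof.
by move=> cZ; apply: csum_glb; [exact: card_sig_le|case=> r Zr; exact: cZ].
Qed.

Lemma inf_csum_glbM Z W c :
  (forall r s, vanishing Z r -> vanishing W s -> idem_le c (nu r * nu s)) ->
  idem_le c (inf_csum Z * inf_csum W).
Proof.
move=> cZW; rewrite csum_mull; last exact: card_sig_le.
apply: csum_glb => [|[r Zr]]; first exact: card_sig_le.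
rewrite csum_mulr; last exact: card_sig_le.
by apply: csum_glb => [|[s Ws]]; [exact: card_sig_le|exact: cZW].
Qed.

Lemma csum_vanishing (Z : zclosed R) :
  Z = csum R (fun r : {r | vanishing Z r} => tau R (sval r)).
Proof.
apply: idem_le_anti.
  by apply: csum_glb; [exact: card_sig_le|case].
apply: vanishing_glb => r Zr.
exact: (@csum_le _ _ _ (fun r => tau R (sval r)) (card_sig_le _) (exist _ r Zr)).
Qed.

Lemma complete_initial : exists! phi : {rmorphism zclosed R -> G},
  preserves_csum R phi /\ (forall r : R, nu r = phi (tau R r)).
Proof.
have [phi phiE] := infimum_rmorphism nu_pos nu_idem
  inf_csum_le inf_csum_glb inf_csum_glbM.
exists phi; split.
  split=> [I b leI|r]; last first.
    by rewrite phiE; apply: infimum_tau => //;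
      [exact: inf_csum_le|exact: inf_csum_glb].
  apply: idem_le_anti.
    apply: csum_glb => // i; rewrite !phiE.
    apply: (@infimum_mono _ _ nu); [exact: inf_csum_le|exact: inf_csum_glb|].
    exact: csum_le.
  (* The sum in [zclosed R] is by construction the intersection of the [b i]. *)
  rewrite [phi (csum _ _)]phiE.
  apply: (infimum_bigcap nu_pos nu_idem inf_csum_le inf_csum_glb (b := b)) => // i.
  by rewrite -phiE; exact: (@csum_le _ _ I (fun i => phi (b i))).
move=> psi [psi_csum psi_tau]; apply: rmorphism_eq => Z.
rewrite phiE [in RHS](csum_vanishing Z) psi_csum; last exact: card_sig_le.
by congr (csum R _); apply: funext => r; exact: psi_tau.
Qed.

End Complete.

(** * The Noetherian case *)

Section Noetherian.
Variables (R : comPzRingType) (G : idemSemiRingType) (nu : valuation R G).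
Hypotheses (nu_pos : positive_valuation nu) (nu_idem : mul_idempotent nu).
Hypothesis noethR : noetherian R.

Lemma vanishing_generators (Z : zclosed R) :
  exists s : seq R, vanishing Z = smallest (@ideal R) [set` s].
Proof.
have iZ : ideal (vanishing Z).
  (* [vanishing Z] is by definition [above Z] for the valuation [tau R]. *)
  exact: (above_ideal (@tau_positive R) Z).
by have [_ /finite_seqP[s ->] ->] := noethR iZ; exists s.
Qed.

Definition generators Z : seq R := sval (cid (vanishing_generators Z)).

Lemma generators_vanishing Z r : r \in generators Z -> vanishing Z r.
Proof.
rewrite /generators; case: cid => s /= -> rs.
by move=> I [_]; apply.
Qed.

(** The elements whose value is above the sum form an ideal containing the generators, hence all of
    [vanishing Z]. Both [nu] and [tau R] will serve as [mu]. *)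
Lemma sum_generators_le (S : idemSemiRingType) (mu : valuation R S) Z r :
  positive_valuation mu -> vanishing Z r ->
  idem_le (\sum_(e <- generators Z) mu e) (mu r).
Proof.
move=> mu_pos; rewrite /generators; case: cid => s /= ->.
apply: (smallest_sub (above_ideal mu_pos (\sum_(e <- s) mu e))).
by move=> e; exact: idem_sum_le.
Qed.

Definition inf_sum (Z : zclosed R) : G := \sum_(e <- generators Z) nu e.

Lemma inf_sum_glb Z c :
  (forall r, vanishing Z r -> idem_le c (nu r)) -> idem_le c (inf_sum Z).
Proof.
by move=> cZ; apply: idem_le_sum => e /generators_vanishing; exact: cZ.
Qed.

Lemma inf_sum_glbM Z W c :
  (forall r s, vanishing Z r -> vanishing W s -> idem_le c (nu r * nu s)) ->
  idem_le c (inf_sum Z * inf_sum W).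
Proof.
move=> cZW; rewrite /inf_sum big_distrlr.
apply: idem_le_sum => r /generators_vanishing Zr.
by apply: idem_le_sum => s /generators_vanishing; exact: cZW.
Qed.

Lemma sum_generators_tau (Z : zclosed R) :
  Z = \sum_(e <- generators Z) tau R e.
Proof.
apply: idem_le_anti; first by apply: idem_le_sum => e /generators_vanishing.
by apply: vanishing_glb => r; apply: sum_generators_le; exact: tau_positive.
Qed.

Lemma noetherian_initial : exists! phi : {rmorphism zclosed R -> G},
  forall r : R, nu r = phi (tau R r).
Proof.
have inf_sum_le Z r : vanishing Z r -> idem_le (inf_sum Z) (nu r).
  exact: sum_generators_le.
have [phi phiE] := infimum_rmorphism nu_pos nu_idem
  inf_sum_le inf_sum_glb inf_sum_glbM.
exists phi; split=> [r|psi psi_tau].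
  rewrite phiE; apply: infimum_tau => //; exact: inf_sum_glb.
apply: rmorphism_eq => Z.
(* The same finite list of generators expresses [Z] and [phi Z], and [psi] commutes with finite
   sums. *)
rewrite phiE [in RHS](sum_generators_tau Z) rmorph_sum.
by apply: eq_bigr => e _; exact: psi_tau.
Qed.

End Noetherian.

Theorem theorem5p11 (R : comPzRingType) :
  (forall (G : cardCompleteType R) (nu : valuation R G),
     positive_valuation nu -> mul_idempotent nu ->
     exists! phi : {rmorphism zclosed R -> G},
       preserves_csum R phi /\ (forall r : R, nu r = phi (tau R r)))
  /\
  (noetherian R ->
   forall (G : idemSemiRingType) (nu : valuation R G),
     positive_valuation nu -> mul_idempotent nu ->
     exists! phi : {rmorphism zclosed R -> G},
       forall r : R, nu r = phi (tau R r)).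
Proof.
split=> [G nu|noethR G nu]; first exact: complete_initial.
by move=> ? ?; exact: noetherian_initial.
Qed.
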